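(* Let $(M,g)$ be a semi-Riemannian manifold of dimension $n\ge 3$. Then $M$ satisfies $$(\ast)\quad g\big((P\cdot\mathcal S)(X_1,X,Y),X_2\big)=(P\cdot S)(X_1,X_2,X,Y)\quad\text{for all vector fields } X_1,X_2,X,Y$$ if and only if $$(S\wedge S)(X_1,X_2,X,Y)=2\,(X\wedge_{S^2}Y)(X_1,X_2)\quad\text{for all vector fields } X_1,X_2,X,Y.$$ Moreover, if $M$ satisfies $(\ast)$, then $nS^2=\kappa S=\frac{\kappa^2}{n}g$, and hence $M$ is Einstein if $\kappa$ is non-zero on $\{x\in M:\left(S-\frac{\kappa}{n}g\right)_x\ne0\}$.
   Context: $(M,g)$ is a connected smooth semi-Riemannian manifold of dimension $n\ge 3$; $R$ is the $(0,4)$ Riemann curvature tensor, with the sign convention that the Ricci tensor $S(X_2,X_3)$ is the $g$-trace of $R(X_1,X_2,X_3,X_4)$ over $X_1,X_4$; $\kappa$ is the scalar curvature; $\mathcal S$ is the Ricci operator, $g(\mathcal SX,Y)=S(X,Y)$, and $S^2(X,Y)=g(\mathcal S^2X,Y)$. Einstein means $S=\frac{\kappa}{n}g$. Projective curvature tensor: $P(X_1,X_2,X_3,X_4)=R(X_1,X_2,X_3,X_4)-\frac{1}{n-1}\left[S(X_2,X_3)g(X_1,X_4)-S(X_1,X_3)g(X_2,X_4)\right]$, with $(1,3)$-version $\mathcal P$ given by $g(\mathcal P(X,Y)X_1,X_2)=P(X,Y,X_1,X_2)$. $(P\cdot S)(X_1,X_2,X,Y)=-S(\mathcal P(X,Y)X_1,X_2)-S(X_1,\mathcal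 P(X,Y)X_2)$ and $(P\cdot\mathcal S)(X_1,X,Y)=\mathcal P(X,Y)\mathcal S X_1-\mathcal S(\mathcal P(X,Y)X_1)$. Kulkarni–Nomizu product: $(A\wedge E)(X_1,X_2,X_3,X_4)=A(X_1,X_4)E(X_2,X_3)+A(X_2,X_3)E(X_1,X_4)-A(X_1,X_3)E(X_2,X_4)-A(X_2,X_4)E(X_1,X_3)$. For a symmetric $(0,2)$-tensor $A$, $(X\wedge_AY)(X_1,X_2)=A(Y,X_1)g(X,X_2)-A(X,X_1)g(Y,X_2)$. *)

(* Defs.v *)
From HB Require Import structures.
From mathcomp Require Import all_boot all_order all_algebra.
From mathcomp Require Import all_classical all_reals all_analysis.
From mathcomp Require Import ring.
Set Implicit Arguments.
Unset Strict Implicit.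
Unset Printing Implicit Defensive.
Import Order.TTheory GRing.Theory Num.Theory.
Import numFieldNormedType.Exports.
Local Open Scope classical_set_scope.
Local Open Scope ring_scope.

(* A smooth manifold is given by an atlas, and tensor fields by their components
   in the charts, subject to the classical transformation laws.  A tangent
   vector at p is a row of components in a chart around p, so T_p M is a copy
   of 'rV[R]_n for each such chart; pointwise identities are stated in every
   chart around every point. *)

Definition evec (R : realType) (n : nat) (i : 'I_n) : 'rV[R]_n := delta_mx 0 i.

Fixpoint Ck_on (R : realType) (n : nat) (k : nat) (D : set 'rV[R]_n)
    (f : 'rV[R]_n -> R) : Prop :=
  match k with
  | 0 => forall u, D u -> {for u, continuous f}
  | k'.+1 => (forall u, D u -> differentiable f u) /\
             forall i : 'I_n, Ck_on k' D (fun u => 'D_(evec R i) f u)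
  end.

(* Only used with D open. *)
Definition smooth_on (R : realType) (n : nat) (D : set 'rV[R]_n)
    (f : 'rV[R]_n -> R) : Prop := forall k, Ck_on k D f.

(* Charts and their inverses are total functions; [phi a] is meaningful on
   [dom a] only and [psi a] on its image only. *)
Record manifold (R : realType) (n : nat) := Manifold {
  carrier :> topologicalType;
  manifold_hausdorff : hausdorff_space carrier;
  manifold_countable : @second_countable carrier;
  chart : Type;
  dom : chart -> set carrier;
  phi : chart -> carrier -> 'rV[R]_n;
  psi : chart -> 'rV[R]_n -> carrier;
  dom_open : forall a, open (dom a);
  dom_cover : forall p, exists a, dom a p;
  phi_open : forall a, open (phi a @` dom a);
  phiK : forall a p, dom a p -> psi a (phi a p) = p;
  phi_continuous : forall a, {within dom a, continuous (phi a)};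
  psi_continuous : forall a, {within phi a @` dom a, continuous (psi a)};
  transition_smooth : forall a b (j : 'I_n),
    smooth_on (phi a @` (dom a `&` dom b)) (fun u => phi b (psi a u) 0 j)
}.

(* The partial derivative of f : M -> R with respect to the k-th coordinate
   of the chart a. *)
Definition pd (R : realType) (n : nat) (M : manifold R n) (a : chart M)
    (k : 'I_n) (f : M -> R) (p : M) : R :=
  'D_(evec R k) (fun u => f (psi a u)) (phi a p).

(* The (i, j) entry is the derivative of the j-th coordinate of b with respect
   to the i-th coordinate of a, as vectors are rows. *)
Definition jacobian (R : realType) (n : nat) (M : manifold R n)
    (a b : chart M) (p : M) : 'M[R]_n :=
  \matrix_(i, j) pd a i (fun q => phi b q 0 j) p.

Record semiRiemannian (R : realType) (n : nat) := SemiRiemannian {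
  base :> manifold R n;
  metric : chart base -> base -> 'M[R]_n;
  metric_sym : forall a p, dom a p -> (metric a p)^T = metric a p;
  metric_nondeg : forall a p, dom a p -> metric a p \in unitmx;
  metric_smooth : forall a (i j : 'I_n),
    smooth_on (phi a @` dom a) (fun u => metric a (psi a u) i j);
  metric_transition : forall a b p, dom a p -> dom b p ->
    metric a p = jacobian a b p *m metric b p *m (jacobian a b p)^T
}.

Record vector_field (R : realType) (n : nat) (M : manifold R n) := VectorField {
  vf_at :> chart M -> M -> 'rV[R]_n;
  vf_smooth : forall a (i : 'I_n),
    smooth_on (phi a @` dom a) (fun u => vf_at a (psi a u) 0 i);
  vf_transition : forall a b p, dom a p -> dom b p ->
    vf_at b p = vf_at a p *m jacobian a b p
}.

Section Curvature.
Context (R : realType) (n : nat) (M : semiRiemannian R n).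
Implicit Types (a : chart M) (p : M) (x y z w : 'rV[R]_n).

Definition gform a p x y : R := (x *m metric a p *m y^T) 0 0.

Definition ginv a p : 'M[R]_n := invmx (metric a p).

Definition gtrace a p (B : 'rV[R]_n -> 'rV[R]_n -> R) : R :=
  \sum_(i < n) \sum_(j < n) ginv a p i j * B (evec R i) (evec R j).

(* The vector metrically equivalent to the linear form theta: see sharpP. *)
Definition sharp a p (theta : 'rV[R]_n -> R) : 'rV[R]_n :=
  (\row_i theta (evec R i)) *m ginv a p.

(* Christoffel symbol Gamma^k_{ij} of the Levi-Civita connection. *)
Definition christoffel a (k i j : 'I_n) p : R :=
  2^-1 * \sum_(l < n) ginv a p k l *
    (pd a i (fun q => metric a q j l) p + pd a j (fun q => metric a q i l) p
     - pd a l (fun q => metric a q i j) p).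

(* R(d_i, d_j) d_k = \sum_l (curvature_coef a l k i j) d_l, for
   R(X, Y) Z = nabla_X nabla_Y Z - nabla_Y nabla_X Z - nabla_[X, Y] Z. *)
Definition curvature_coef a (l k i j : 'I_n) p : R :=
  pd a i (christoffel a l j k) p - pd a j (christoffel a l i k) p
  + \sum_(m < n) (christoffel a l i m p * christoffel a m j k p
                  - christoffel a l j m p * christoffel a m i k p).

Definition curvature a p x y z : 'rV[R]_n :=
  \row_l \sum_(i < n) \sum_(j < n) \sum_(k < n)
    x 0 i * y 0 j * z 0 k * curvature_coef a l k i j p.

Definition Riem a p x1 x2 x3 x4 : R := gform a p (curvature a p x1 x2 x3) x4.

Definition Ric a p x2 x3 : R := gtrace a p (fun x1 x4 => Riem a p x1 x2 x3 x4).

Definition scal a p : R := gtrace a p (Ric a p).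

Definition RicOp a p x : 'rV[R]_n := sharp a p (Ric a p x).

Definition Ric2 a p x y : R := gform a p (RicOp a p (RicOp a p x)) y.

Definition Proj a p x1 x2 x3 x4 : R :=
  Riem a p x1 x2 x3 x4 - (n%:R - 1)^-1 *
    (Ric a p x2 x3 * gform a p x1 x4 - Ric a p x1 x3 * gform a p x2 x4).

Definition ProjOp a p x y x1 : 'rV[R]_n := sharp a p (Proj a p x y x1).

Definition P_Ric a p x1 x2 x y : R :=
  - Ric a p (ProjOp a p x y x1) x2 - Ric a p x1 (ProjOp a p x y x2).

Definition P_RicOp a p x1 x y : 'rV[R]_n :=
  ProjOp a p x y (RicOp a p x1) - RicOp a p (ProjOp a p x y x1).

Definition kulkarni_nomizu (A E : 'rV[R]_n -> 'rV[R]_n -> R) x1 x2 x3 x4 : R :=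
  A x1 x4 * E x2 x3 + A x2 x3 * E x1 x4
  - A x1 x3 * E x2 x4 - A x2 x4 * E x1 x3.

(* (x /\_A y)(x1, x2) *)
Definition wedge_end a p (A : 'rV[R]_n -> 'rV[R]_n -> R) x y x1 x2 : R :=
  A y x1 * gform a p x x2 - A x x1 * gform a p y x2.

Lemma sharpP a p theta : dom a p -> scalar theta ->
  forall y, gform a p (sharp a p theta) y = theta y.
Proof.
move=> ap lin y; rewrite /gform /sharp mulmxKV ?metric_nondeg//.
have thetaD u v : theta (u + v) = theta u + theta v.
  by have := lin 1 u v; rewrite scale1r mul1r.
have theta0 : theta 0 = 0.
  by apply: (addrI (theta 0)); rewrite -thetaD !addr0.
have thetaZ c v : theta (c *: v) = c * theta v.
  by have := lin c v 0; rewrite !addr0 theta0 addr0.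
rewrite [in RHS](row_sum_delta y) (big_morph theta thetaD theta0) mxE.
by apply: eq_bigr => i _; rewrite thetaZ !mxE mulrC.
Qed.

Lemma gform_scalar a p x : scalar (gform a p x).
Proof. by move=> c y z; rewrite /gform linearP mulmxDr -scalemxAr !mxE. Qed.

Lemma Ric_scalar a p x : scalar (Ric a p x).
Proof.
move=> c y z; rewrite /Ric /gtrace mulr_sumr -big_split; apply: eq_bigr => i _.
rewrite mulr_sumr -big_split; apply: eq_bigr => j _ /=.
rewrite mulrCA -mulrDr; congr (_ * _); rewrite /Riem.
have -> : curvature a p (evec R i) x (c *: y + z) =
   c *: curvature a p (evec R i) x y + curvature a p (evec R i) x z.
  apply/rowP => l; rewrite !mxE; do 3! (rewrite mulr_sumr -big_split; apply: eq_bigr => ? _ /=).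
  by rewrite !mxE; ring.
by rewrite /gform !mulmxDl -!scalemxAl !mxE.
Qed.

Lemma RicOpP a p x y : dom a p -> gform a p (RicOp a p x) y = Ric a p x y.
Proof. by move=> ap; apply: sharpP => //; apply: Ric_scalar. Qed.

Lemma ProjOpP a p x y x1 x2 : dom a p ->
  gform a p (ProjOp a p x y x1) x2 = Proj a p x y x1 x2.
Proof.
move=> ap; apply: sharpP => // c u v; rewrite /Proj /Riem !gform_scalar.
ring.
Qed.

End Curvature.

(* g((P.S)(X1, X, Y), X2) = (P.S)(X1, X2, X, Y), with the Ricci operator on the
   left and the Ricci tensor on the right. *)
Definition star_condition (R : realType) (n : nat) (M : semiRiemannian R n) : Prop :=
  forall X1 X2 X Y : vector_field M, forall (a : chart M) (p : M), dom a p ->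
    gform a p (P_RicOp a p (X1 a p) (X a p) (Y a p)) (X2 a p)
    = P_Ric a p (X1 a p) (X2 a p) (X a p) (Y a p).

Definition wedge_condition (R : realType) (n : nat) (M : semiRiemannian R n) : Prop :=
  forall X1 X2 X Y : vector_field M, forall (a : chart M) (p : M), dom a p ->
    kulkarni_nomizu (Ric a p) (Ric a p) (X1 a p) (X2 a p) (X a p) (Y a p)
    = 2 * wedge_end a p (Ric2 a p) (X a p) (Y a p) (X1 a p) (X2 a p).

Definition Einstein (R : realType) (n : nat) (M : semiRiemannian R n) : Prop :=
  forall (a : chart M) (p : M), dom a p ->
    forall x y, Ric a p x y = scal a p / n%:R * gform a p x y.

(* Main.v *)
(** The Ricci operator is self-adjoint for [g], so the first condition says
   that [P(X, Y, S X1, X2)] is skew under exchanging [S X1] and [X2].  The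
   Riemann tensor is itself skew in its last two arguments, so it drops out of
   the symmetrization of [P], and what remains is a nonzero multiple of the
   difference of the two sides of the second condition.  Contracting that
   identity over [(X, X2)] gives [n S^2 = kappa S], and over [(Y, X1)] gives
   [tr(S^2) g = kappa S]; hence [kappa S = kappa^2/n g], and [S = kappa/n g]
   wherever [kappa] is not zero.

   Contracting at a point requires arbitrary tangent vectors there, and the
   conditions quantify over global vector fields: a constant field in a chart is
   cut off by a bump function.  The symmetries of the curvature are
   derived from its coordinate expression and the symmetry of second
   derivatives. *)

Require Import Defs.
From mathcomp Require Import all_boot all_order all_algebra.
From mathcomp Require Import all_classical all_reals all_analysis.
From mathcomp Require Import ring lra.
Set Implicit Arguments.
Unset Strict Implicit.
Unset Printing Implicit Defensive.
Import Order.TTheory GRing.Theory Num.Theory.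
Import numFieldNormedType.Exports.
Local Open Scope classical_set_scope.
Local Open Scope ring_scope.

(** * Mean value theorem and symmetry of second derivatives *)

Section Calculus.
Context {R : realType}.

(** The first-order expansion of [f] at [x] involves only values near [x], so it is also one of [g].
    Needed because functions on charts are compared only on open chart images. *)
Lemma near_eq_differentiable (V W : normedModType R) (f g : V -> W) (x : V) :
  (\near x, f x = g x) -> differentiable f x -> differentiable g x.
Proof.
move=> fg df; have [dfc dfE] := (diff_locallyP _ _).1 df.
have gE : g \o shift x = cst (g x) + 'd f x +o_ 0 id.
  apply/eqaddoP => e e0; have /eqaddoP /(_ e e0) := dfE.
  have : \forall h \near (0 : V), f (h + x) = g (h + x).
    by move: fg; rewrite (near_shift 0 x) subr0.
  apply: filterS2 => h /= fgh; rewrite !fctE /=.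
  by rewrite -fgh (nbhs_singleton fg).
by apply/diff_locallyP; rewrite (diff_unique dfc gE).
Qed.

Lemma derive_translate (V W : normedModType R) (f : V -> W) (c x v : V) :
  'D_v (fun y => f (y + c)) x = 'D_v f (x + c).
Proof.
rewrite /derive; set F := fun _ => _; set G := fun _ => _.
by suff -> : F = G; [|apply/funext => h; rewrite /F /G /= addrA].
Qed.

Lemma derive_line (V W : normedModType R) (f : V -> W) (a v : V) (s : R) :
  'D_1 (fun t : R => f (t *: v + a)) s = 'D_v f (s *: v + a).
Proof.
rewrite /derive; set F := fun _ => _; set G := fun _ => _.
suff -> : F = G by [].
by apply/funext => h; rewrite /F /G /= [h *: 1]mulr1 scalerDl addrA.
Qed.

Lemma MVT_line (V : normedModType R) (f : V -> R) (a v : V) (h : R) : 0 < h ->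
  (forall s, 0 <= s <= h -> differentiable f (s *: v + a)) ->
  exists2 c, 0 < c < h & f (h *: v + a) - f a = 'D_v f (c *: v + a) * h.
Proof.
move=> h0 df; pose F (t : R) := f (t *: v + a).
have dF s : 0 <= s <= h -> differentiable F s.
  by move=> sh; apply: differentiable_comp; [|exact: df].
have [||c] := @MVT R F (fun s => 'D_v f (s *: v + a)) 0 h h0.
- move=> s; rewrite in_itv /= => /andP[s0 sh]; apply: DeriveDef.
    by apply/derivable1_diffP/dF; rewrite !ltW.
  exact: derive_line.
- apply/continuous_in_subspaceT => s; rewrite inE /= in_itv /= => sh.
  exact/differentiable_continuous/dF.
- by rewrite in_itv /= => ch; rewrite /F scale0r add0r subr0; exists c.
Qed.

(* Two applications of the mean value theorem to the second difference of [f]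
   along [v] and [w], which is symmetric in [v] and [w]. *)
Lemma second_difference (V : normedModType R) (f : V -> R) (u v w : V) (h r : R) :
  0 < h -> `|v| <= 1 -> `|w| <= 1 -> 2 * h < r ->
  (forall x, ball u r x -> differentiable f x) ->
  (forall x, ball u r x -> differentiable ('D_v f) x) ->
  exists2 x, ball u r x &
    f (h *: v + (h *: w + u)) - f (h *: v + u) - f (h *: w + u) + f u
    = 'D_w ('D_v f) x * h * h.
Proof.
move=> h0 v1 w1 hr df ddf.
have inB s t : 0 <= s <= h -> 0 <= t <= h -> ball u r (s *: v + (t *: w + u)).
  move=> /andP[s0 sh] /andP[t0 th]; rewrite -ball_normE /= addrA opprD addrCA.
  rewrite subrr addr0 normrN (le_lt_trans (ler_normD _ _))//.
  rewrite !normrZ !ger0_norm//; apply: le_lt_trans hr.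
  have : s * `|v| <= h * 1 by apply: ler_pM.
  have : t * `|w| <= h * 1 by apply: ler_pM.
  lra.
have hh : 0 <= h <= h by rewrite ltW /=.
have z0 : 0 <= (0 : R) <= h by rewrite lexx ltW.
have inB0 s : 0 <= s <= h -> ball u r (s *: v + u).
  by move=> sh; have := inB s 0 sh z0; rewrite scale0r add0r.
pose g x := f (x + h *: w) - f x.
have dsh x : 0 <= x <= h ->
    differentiable (fun y => f (y + h *: w)) (x *: v + u).
  move=> xh; apply: differentiable_comp; first exact: differentiableD.
  by rewrite -addrA [u + _]addrC; apply/df/inB.
have [s sh|s /andP[s0 sh]] := @MVT_line V g u v h h0.
  by apply: differentiableB; [exact: dsh|exact/df/inB0].
have sh' : 0 <= s <= h by rewrite !ltW.
rewrite [X in _ = X * _ -> _](_ : _ =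
    'D_v f (h *: w + (s *: v + u)) - 'D_v f (s *: v + u)); last first.
  rewrite [LHS]deriveB; last 2 first.
  - exact/diff_derivable/dsh.
  - exact/diff_derivable/df/inB0.
  by rewrite derive_translate [h *: w + _]addrC.
have [t th|t /andP[t0 th] ->] := @MVT_line V ('D_v f) (s *: v + u) w h h0.
  by rewrite addrCA; apply/ddf/inB.
move=> E; exists (t *: w + (s *: v + u)).
  by rewrite addrCA; apply: inB; rewrite // !ltW.
rewrite -E /g (addrC (h *: w) u) (addrA (h *: v) u); ring.
Qed.

(** The same second difference, divided by [h * h], equals one mixed derivative at some [x] and the
    other at some [y], both close to [u]. By continuity each is within [e / 2] of its value at [u],
    so these values differ by at most [e], for every [e]. *)
Lemma derive_comm (V : normedModType R) (f : V -> R) (u v w : V) :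
  `|v| <= 1 -> `|w| <= 1 ->
  (\forall x \near u, differentiable f x) ->
  (\forall x \near u, differentiable ('D_v f) x) ->
  (\forall x \near u, differentiable ('D_w f) x) ->
  {for u, continuous ('D_w ('D_v f))} ->
  {for u, continuous ('D_v ('D_w f))} ->
  'D_v ('D_w f) u = 'D_w ('D_v f) u.
Proof.
move=> v1 w1 df dvf dwf /cvgrPdist_lt cwv /cvgrPdist_lt cvw.
apply/eqP; rewrite -subr_eq0 -normr_eq0 eq_le normr_ge0 andbT.
apply/ler_addgt0Pl => e e0; rewrite addr0.
have e20 : 0 < e / 2 by rewrite divr_gt0.
have {}cwv := cwv _ e20; have {}cvw := cvw _ e20.
have /nbhs_ballP[r /= r0 Br] : nbhs u (fun x => [/\ differentiable f x,
    differentiable ('D_v f) x, differentiable ('D_w f) x,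
    `|'D_w ('D_v f) u - 'D_w ('D_v f) x| < e / 2 &
    `|'D_v ('D_w f) u - 'D_v ('D_w f) x| < e / 2]).
  have F : Filter (nbhs u) := nbhs_filter u.
  have H := @filterI _ _ F _ _ df (@filterI _ _ F _ _ dvf (@filterI _ _ F _ _ dwf
    (@filterI _ _ F _ _ cwv cvw))).
  apply: (@filterS _ _ F _ _ _ H) => x [a [b [c [d d']]]].
  exact (And5 a b c d d').
pose h := r / 4; have h0 : 0 < h by rewrite divr_gt0.
have hr : 2 * h < r by rewrite /h; lra.
have [x /Br[_ _ _ xe _] Ex] := second_difference h0 v1 w1 hr
  (fun x Bx => let: And5 H _ _ _ _ := Br x Bx in H)
  (fun x Bx => let: And5 _ H _ _ _ := Br x Bx in H).
have [y /Br[_ _ _ _ ye] Ey] := second_difference h0 w1 v1 hr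
  (fun x Bx => let: And5 H _ _ _ _ := Br x Bx in H)
  (fun x Bx => let: And5 _ _ H _ _ := Br x Bx in H).
(* [Ex] and [Ey] evaluate the same second difference, with [v] and [w] exchanged. *)
have xy : 'D_w ('D_v f) x = 'D_v ('D_w f) y.
  have hn0 : h != 0 by rewrite gt_eqF.
  suff E : 'D_w ('D_v f) x * h * h = 'D_v ('D_w f) y * h * h.
    exact: (mulIf hn0 (mulIf hn0 E)).
  apply: (etrans (esym Ex)); apply: (etrans _ Ey).
  by rewrite (addrCA (h *: v) (h *: w) u); congr (_ + _); rewrite addrAC.
move: xe ye xy; move: ('D_w ('D_v f) u) ('D_w ('D_v f) x) ('D_v ('D_w f) u)
  ('D_v ('D_w f) y) => a c b d ac bd cd; rewrite {c}cd in ac.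
rewrite (splitr e) -(subrKA d) (le_trans (ler_normD _ _))//.
by apply: (lerD (ltW bd)); rewrite distrC ltW.
Qed.

Lemma differentiable_rows (V : normedModType R) (n : nat) (g : V -> 'rV[R]_n)
    (u : V) :
  (forall j, differentiable (fun x => g x 0 j) u) -> differentiable g u.
Proof.
move=> dg; rewrite (_ : g = \sum_(j < n) (fun x => g x 0 j *: evec R j)).
  by apply: differentiable_sum => j; exact: differentiableZl.
apply/funext => x; rewrite [LHS]row_sum_delta.
by elim/big_ind2 : _ => // ? ? ? ? -> ->.
Qed.

Lemma derive_comp_rows (V : normedModType R) (n : nat) (f : 'rV[R]_n -> R)
    (g : V -> 'rV[R]_n) (u v : V) :
  differentiable f (g u) -> (forall j, differentiable (fun x => g x 0 j) u) ->
  'D_v (fun x => f (g x)) u =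
    \sum_(j < n) 'D_(evec R j) f (g u) * 'D_v (fun x => g x 0 j) u.
Proof.
move=> df dg; have dgu := differentiable_rows dg.
rewrite [LHS]deriveE; last exact: differentiable_comp.
rewrite [in LHS]diff_comp //= -(deriveE v dgu) derive_mx; last exact: diff_derivable.
rewrite [X in 'd f (g u) X]row_sum_delta linear_sum; apply: eq_bigr => j _.
by rewrite linearZ mxE /= -deriveE// mulrC.
Qed.

Lemma derive_coord (m n : nat) (i : 'I_m) (j : 'I_n) (u v : 'M[R]_(m, n)) :
  'D_v (fun x : 'M[R]_(m, n) => x i j : R) u = v i j.
Proof.
have := derive_mx (@derivable_id R 'M[R]_(m, n) u v); rewrite derive_id.
by move=> /matrixP /(_ i j); rewrite mxE => ->.
Qed.

End Calculus.

(** * Functions of class C^k *)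

Section SmoothFunctions.
Context {R : realType} {n : nat}.
Implicit Types (D E : set 'rV[R]_n) (f g : 'rV[R]_n -> R).

Lemma near_eq_on D f g u : open D -> {in D, f =1 g} -> D u ->
  \near u, f u = g u.
Proof.
move=> Dop fg Du; near=> w; apply: fg; rewrite inE; near: w.
exact: open_nbhs_nbhs.
Unshelve. all: by end_near. Qed.

Lemma derive_eq_on D f g u v : open D -> {in D, f =1 g} -> D u ->
  'D_v f u = 'D_v g u.
Proof. by move=> Dop fg Du; exact: (near_eq_derive _ (near_eq_on Dop fg Du)). Qed.

(* Destructing [Ck_on k.+1] directly would expose the raw fixpoint. *)
Lemma Ck_on_succ k D f : Ck_on k.+1 D f <->
  (forall u, D u -> differentiable f u) /\
  forall i, Ck_on k D ('D_(evec R i) f).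
Proof. by []. Qed.

Lemma Ck_onW k D f : Ck_on k.+1 D f -> Ck_on k D f.
Proof.
elim: k f => [|k IH] f /Ck_on_succ[df ddf].
  by move=> u /df/differentiable_continuous.
by apply/Ck_on_succ; split=> // i; apply: IH.
Qed.

(** The clauses of [Ck_on] are pointwise, with derivatives taken in the ambient space. This lets a
    function be handled by different formulas around different points. *)
Lemma Ck_on_local k D f :
  (forall u, D u -> exists2 U, U u & Ck_on k U f) -> Ck_on k D f.
Proof.
elim: k f => [|k IH] f loc; first by move=> u /loc[U Uu]; apply.
apply/Ck_on_succ; split=> [u /loc[U Uu /Ck_on_succ[dfU _]]|i]; first exact: dfU.
by apply: IH => u /loc[U Uu /Ck_on_succ[_ dfU]]; exists U.
Qed.

(** Openness of [D] turns equality on [D] into equality near each of its points, so the partial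
    derivatives agree on [D] too and the induction goes on. *)
Lemma eq_Ck_on k D f g : open D -> {in D, f =1 g} -> Ck_on k D f -> Ck_on k D g.
Proof.
move=> Dop; elim: k f g => [|k IH] f g fg.
  move=> cf u Du; have nfg := near_eq_on Dop fg Du.
  have cfu : f w @[w --> u] --> f u by exact: cf.
  rewrite (nbhs_singleton nfg) in cfu.
  exact: cvg_trans (near_eq_cvg nfg) cfu.
move=> /Ck_on_succ[df ddf]; apply/Ck_on_succ; split=> [u Du|i].
  by apply: near_eq_differentiable (df u Du); exact: near_eq_on Du.
apply: IH (ddf i) => u; rewrite inE => Du.
exact: (derive_eq_on _ Dop fg Du).
Qed.

Lemma Ck_on_cst k D (c : R) : Ck_on k D (fun _ => c).
Proof.
elim: k c => [|k IH] c.
  by move=> u _; exact/differentiable_continuous/differentiable_cst.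
apply/Ck_on_succ; split=> [u _|i]; first exact: differentiable_cst.
rewrite (_ : 'D__ _ = fun _ => 0) //.
by apply/funext => u; exact: derive_cst.
Qed.

Lemma Ck_on_coord k D (j : 'I_n) : Ck_on k D (fun u => u 0 j).
Proof.
case: k => [|k]; first by move=> u _; exact: coord_continuous.
apply/Ck_on_succ; split=> [u _|i]; first exact: differentiable_coord.
rewrite (_ : 'D__ _ = fun _ => evec R i 0 j); first exact: Ck_on_cst.
by apply/funext => u; exact: derive_coord.
Qed.

Lemma Ck_onD k D f g : open D -> Ck_on k D f -> Ck_on k D g ->
  Ck_on k D (fun u => f u + g u).
Proof.
move=> Dop; elim: k f g => [|k IH] f g.
  by move=> cf cg u Du; apply: continuousD; [exact: (cf u Du)|exact: (cg u Du)].
move=> /Ck_on_succ[df ddf] /Ck_on_succ[dg ddg]; apply/Ck_on_succ; split=> [u Du|i].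
  by apply: differentiableD; [exact: df|exact: dg].
apply: eq_Ck_on (IH _ _ (ddf i) (ddg i)) => // u; rewrite inE => Du.
by rewrite [RHS]deriveD//; apply: diff_derivable; [exact: df|exact: dg].
Qed.

Lemma Ck_onM k D f g : open D -> Ck_on k D f -> Ck_on k D g ->
  Ck_on k D (fun u => f u * g u).
Proof.
move=> Dop; elim: k f g => [|k IH] f g.
  by move=> cf cg u Du; apply: continuousM; [exact: (cf u Du)|exact: (cg u Du)].
move=> Cf Cg; have /Ck_on_succ[df ddf] := Cf; have /Ck_on_succ[dg ddg] := Cg.
apply/Ck_on_succ; split=> [u Du|i].
  by apply: differentiableM; [exact: df|exact: dg].
apply: (@eq_Ck_on k D (fun u => f u * 'D_(evec R i) g u + g u * 'D_(evec R i) f u)) => //.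
  move=> u; rewrite inE => Du.
  by rewrite [RHS]deriveM//; apply: diff_derivable; [exact: df|exact: dg].
by apply: Ck_onD => //; apply: IH => //; exact: Ck_onW.
Qed.

Lemma Ck_on_sum k D (I : Type) (r : seq I) (P : pred I) (F : I -> 'rV[R]_n -> R) :
  open D -> (forall i, P i -> Ck_on k D (F i)) ->
  Ck_on k D (fun u => \sum_(i <- r | P i) F i u).
Proof.
move=> Dop CF; rewrite (_ : (fun u => _) = \sum_(i <- r | P i) F i).
  elim/big_ind : _ => //; first exact: Ck_on_cst.
  by move=> f g; exact: Ck_onD.
by apply/funext => u; rewrite fct_sumE.
Qed.

Lemma Ck_on_prod k D (I : Type) (r : seq I) (P : pred I) (F : I -> 'rV[R]_n -> R) :
  open D -> (forall i, P i -> Ck_on k D (F i)) ->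
  Ck_on k D (fun u => \prod_(i <- r | P i) F i u).
Proof.
move=> Dop CF; elim: r => [|i r IH].
  rewrite (_ : (fun u => _) = fun _ => 1); first exact: Ck_on_cst.
  by apply/funext => u; rewrite big_nil.
rewrite (_ : (fun u => _) =
    fun u => (if P i then F i u else 1) * \prod_(i <- r | P i) F i u).
  by apply: Ck_onM => //; case: (boolP (P i)) => [/CF|_] //; exact: Ck_on_cst.
by apply/funext => u; rewrite big_cons; case: ifP => _; rewrite ?mul1r.
Qed.

End SmoothFunctions.

(** By the chain rule a partial derivative of the composite is a sum of products of a partial
    derivative of [f] composed with [g], covered by the induction hypothesis, and a partial
    derivative of a coordinate of [g]. *)
Lemma Ck_on_comp (R : realType) (m n k : nat) (D : set 'rV[R]_m)
    (E : set 'rV[R]_n) (f : 'rV[R]_n -> R) (g : 'rV[R]_m -> 'rV[R]_n) :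
  open D -> (forall u, D u -> E (g u)) ->
  Ck_on k E f -> (forall j, smooth_on D (fun u => g u 0 j)) ->
  Ck_on k D (fun u => f (g u)).
Proof.
move=> Dop DE; elim: k f => [|k IH] f Cf Cg.
  move=> u Du; apply: continuous_comp; last exact/Cf/DE.
  apply/differentiable_continuous/differentiable_rows => j.
  by have /Ck_on_succ[dg _] := Cg j 1%N; exact: dg.
have /Ck_on_succ[df ddf] := Cf; apply/Ck_on_succ; split=> [u Du|i].
  apply: differentiable_comp; last exact/df/DE.
  by apply: differentiable_rows => j; have /Ck_on_succ[dg _] := Cg j 1%N; exact: dg.
apply: (@eq_Ck_on R m k D (fun u => \sum_(j < n)
    'D_(evec R j) f (g u) * 'D_(evec R i) (fun x => g x 0 j) u)) => //.
  move=> u; rewrite inE => Du; rewrite [RHS]derive_comp_rows//; first exact/df/DE.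
  by move=> j; have /Ck_on_succ[dg _] := Cg j 1%N; exact: dg.
apply: Ck_on_sum => // j _; apply: Ck_onM => //; first exact: (IH ('D_(evec R j) f)).
by have /Ck_on_succ[_ ddg] := Cg j k.+1; exact: ddg.
Qed.

(** * Bump functions *)

Section Flat.
Context {R : realType}.

(* The extra factors t^-N make the span of the family closed under
   differentiation, so one induction proves all its members smooth. *)
Definition flat (N : nat) (t : R) : R :=
  if 0 < t then t^-1 ^+ N * expR (- t^-1) else 0.

Lemma flat_gt0 N t : 0 < t -> 0 < flat N t.
Proof.
by move=> t0; rewrite /flat t0 mulr_gt0 ?expR_gt0// exprn_gt0// invr_gt0.
Qed.

Lemma flat_le0 N t : t <= 0 -> flat N t = 0.
Proof. by move=> t0; rewrite /flat ltNge t0. Qed.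

Lemma flat_bound N t : `|flat N t| <= N.+1`!%:R * `|t|.
Proof.
have [t0|t0] := ltP 0 t; last first.
  by rewrite flat_le0// normr0 mulr_ge0.
rewrite gtr0_norm ?flat_gt0// gtr0_norm// /flat t0 expRN ler_pdivrMr ?expR_gt0//.
have ti : 0 <= t^-1 by rewrite invr_ge0 ltW.
have f0 : 0 < N.+1`!%:R :> R by rewrite ltr0n fact_gt0.
have le1 : t^-1 ^+ N.+1 <= N.+1`!%:R * expR t^-1.
  rewrite mulrC -ler_pdivrMr//; apply: le_trans (expR_ge1Dxn N ti).
  by rewrite lerDr.
rewrite mulrAC -ler_pdivrMr// mulrC -exprS; exact: le1.
Qed.

Lemma is_derive_flat (N : nat) (t : R) :
  is_derive t 1 (flat N) (flat N.+2 t - N%:R * flat N.+1 t).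
Proof.
have [t0|t0|<-] := ltgtP 0 t.
- have tn0 : t != 0 by rewrite gt_eqF.
  have dV := is_deriveV (f := id) tn0 (is_derive_id t (1 : R)).
  have dX := is_deriveX N dV.
  have dE := is_derive1_comp (f := expR) (g := - GRing.inv) (is_derive_expR _)
    (is_deriveN dV).
  have dM := is_deriveM dX dE.
  apply: (near_eq_is_derive _ (is_derive_eq dM _)).
    near=> y; have y0 : 0 < y by near: y; exact: lt_nbhsr.
    by rewrite /flat y0 /= fctE exprfctE.
  rewrite /= !exprfctE /flat t0 /GRing.scale /=.
  rewrite (_ : (- GRing.inv) t = - t^-1)// -exprVn.
  case: N {dX dM} => [|N] /=; first by ring.
  by rewrite !exprS; move: (N.+1%:R : R) => c; ring.
- rewrite !(flat_le0 _ (ltW t0)) mulr0 subr0.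
  apply: (near_eq_is_derive _ (is_derive_cst 0 t 1)).
  near=> y; rewrite flat_le0//; apply: ltW; near: y; exact: lt_nbhsl.
(* At 0 the difference quotient of [flat N] is [flat N.+1], which tends to 0 by [flat_bound]. *)
- rewrite !flat_le0// mulr0 subr0.
  suff cv : h^-1 *: (flat N (h *: 1 + 0) - flat N 0) @[h --> 0^'] --> (0 : R).
    by apply: DeriveDef; [apply/cvg_ex; exists 0|exact: cvg_lim cv].
  apply/cvgrPdist_lt => e e0.
  have f0 : 0 < N.+2`!%:R :> R by rewrite ltr0n fact_gt0.
  near=> h; rewrite sub0r normrN (flat_le0 N (lexx 0)) subr0 addr0 [h *: 1]mulr1.
  have -> : h^-1 *: flat N h = flat N.+1 h.
    by rewrite /flat; case: ifP => _; rewrite ?scaler0// exprS -mulrA.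
  apply: le_lt_trans (flat_bound _ _) _; rewrite mulrC -ltr_pdivlMr//.
  by near: h; apply: dnbhs0_lt; rewrite divr_gt0.
Unshelve. all: by end_near. Qed.

Lemma Ck_on_flat (n k N : nat) (D : set 'rV[R]_n) (g : 'rV[R]_n -> R) :
  open D -> Ck_on k D g -> Ck_on k D (fun u => flat N (g u)).
Proof.
move=> Dop; have dflat M t : differentiable (flat M) t.
  by apply/derivable1_diffP; apply: ex_derive; exact: is_derive_flat.
elim: k N g => [|k IH] N g Cg.
  move=> u Du; apply: continuous_comp; first exact: Cg.
  exact/differentiable_continuous/dflat.
have /Ck_on_succ[dg ddg] := Cg; have Ckg := Ck_onW Cg.
apply/Ck_on_succ; split=> [u Du|i].
  by apply: differentiable_comp; [exact: dg|exact: dflat].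
apply: (@eq_Ck_on R n k D (fun u =>
    (flat N.+2 (g u) + - N%:R * flat N.+1 (g u)) * 'D_(evec R i) g u)) => //.
  move=> u; rewrite inE => Du.
  rewrite [RHS]deriveE; last by apply: differentiable_comp; [exact: dg|exact: dflat].
  rewrite diff_comp /=; [|exact: dg|exact: dflat].
  rewrite -(deriveE _ (dg u Du)).
  rewrite diff1E // derive1E (@derive_val _ _ _ _ _ _ _ (is_derive_flat N (g u))).
  by rewrite mulNr mulrC.
apply: Ck_onM => //; apply: Ck_onD => //; first exact: IH.
by apply: Ck_onM => //; [exact: Ck_on_cst|exact: IH].
Qed.

Context (n : nat).
Implicit Types c u : 'rV[R]_n.

(** A product over the coordinates, so that the bump vanishes outside a closed cube, a set whose
    compactness follows from that of segments. *)
Definition box_bump c (r : R) u : R :=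
  \prod_(i < n) flat 0 (r ^+ 2 - (u 0 i - c 0 i) ^+ 2).

Lemma box_bump_smooth c r D : open D -> smooth_on D (box_bump c r).
Proof.
move=> Dop k; apply: Ck_on_prod => // i _; apply: Ck_on_flat => //.
have Cc : Ck_on k D (fun u => u 0 i + - c 0 i).
  by apply: Ck_onD => //; [exact: Ck_on_coord|exact: Ck_on_cst].
rewrite (_ : (fun u => _) =
    fun u => r ^+ 2 + - 1 * ((u 0 i + - c 0 i) * (u 0 i + - c 0 i))).
  apply: Ck_onD => //; first exact: Ck_on_cst.
  by apply: Ck_onM => //; [exact: Ck_on_cst|exact: Ck_onM].
by apply/funext => u; rewrite mulN1r expr2.
Qed.

Lemma box_bump_center c r : 0 < r -> box_bump c r c != 0.
Proof.
move=> r0; apply/prodf_neq0 => i _.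
by rewrite subrr expr0n subr0 gt_eqF// flat_gt0// exprn_gt0.
Qed.

Definition box c r : set 'rV[R]_n :=
  [set u | forall i, u 0 i \in `[c 0 i - r, c 0 i + r]].

Lemma box_bump_out c r u : 0 < r -> ~ box c r u -> box_bump c r u = 0.
Proof.
move=> r0 /existsNP[i ui]; apply/eqP/prodf_eq0; exists i => //.
apply/eqP/flat_le0; rewrite leNgt; apply/negP => lt0; apply: ui.
rewrite in_itv /=; move: lt0; set x := u 0 i; set y := c 0 i => lt0.
by apply/andP; split; rewrite leNgt; apply/negP => h; nra.
Qed.

Lemma box_compact c r : compact (box c r).
Proof.
exact: (@rV_compact R n (fun i => `[c 0 i - r, c 0 i + r]%classic)
  (fun i => @segment_compact _ _ _)).
Qed.

Lemma box_sub_nbhs c (A : set 'rV[R]_n) : nbhs c A ->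
  exists2 r : R, 0 < r & box c r `<=` A.
Proof.
(* Halving the radius puts the closed box inside the open ball of the maximum norm. *)
move=> /nbhs_ballP[e /= e0 eA]; exists (e / 2); first by rewrite divr_gt0.
move=> u cu; apply: eA; split=> // i j; rewrite ord1; have := cu j.
rewrite /ball /= in_itv /= => /andP[h1 h2]; rewrite ltr_norml; apply/andP; split; lra.
Qed.

End Flat.

(** * Extension of tangent vectors to vector fields *)

Section Charts.
Context {R : realType} {n : nat} {M : manifold R n}.
Implicit Types (a b c : chart M) (p q : M).

(** The image is the part of the open chart image that the continuous map [psi a] sends into [U]. *)
Lemma chart_image_open a (U : set M) : open U -> open (phi a @` (dom a `&` U)).
Proof.
move=> Uop; rewrite (_ : _ @` _ = (phi a @` dom a) `&` psi a @^-1` U).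
  have := @psi_continuous _ _ M a; rewrite continuous_open_subspace; last exact: phi_open.
  by move=> /(continuous_inP _ (@phi_open _ _ M a)); apply.
apply/seteqP; split=> [_ [q [aq Uq] <-]|_ [[q aq <-]]] /=.
  by split; [exists q|rewrite /= phiK].
by rewrite phiK// => Uq; exists q.
Qed.

Lemma overlap_open a b : open (phi a @` (dom a `&` dom b)).
Proof. exact: chart_image_open (@dom_open _ _ M b). Qed.

Lemma differentiable_transition a b p (j : 'I_n) : dom a p -> dom b p ->
  differentiable (fun u => phi b (psi a u) 0 j) (phi a p).
Proof.
move=> ap bp; have /Ck_on_succ[d _] := transition_smooth a b j 1%N.
by apply: d; exists p.
Qed.

(** The chain rule for the transition from [a] to [c], factored through [b] on the overlap of [a]
    and [b]. *)
Lemma jacobian_trans a b c p : dom a p -> dom b p -> dom c p ->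
  Defs.jacobian a c p = Defs.jacobian a b p *m Defs.jacobian b c p.
Proof.
move=> ap bp cp; apply/matrixP => i j; rewrite !mxE /pd.
rewrite (@derive_eq_on _ _ _ _
    (fun u => phi c (psi b (phi b (psi a u))) 0 j) _ _ (@overlap_open a b)); last first.
- by exists p.
- by move=> u; rewrite inE => -[q [aq bq] <-]; rewrite !phiK.
rewrite (@derive_comp_rows R _ n (fun w => phi c (psi b w) 0 j)
  (fun u => phi b (psi a u))).
- by apply: eq_bigr => l _; rewrite !mxE /pd phiK// mulrC.
- by rewrite phiK//; exact: differentiable_transition.
- by move=> l; exact: differentiable_transition.
Qed.

Lemma jacobian_id a p : dom a p -> Defs.jacobian a a p = 1%:M.
Proof.
move=> ap; apply/matrixP => i j; rewrite !mxE /pd.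
rewrite (@derive_eq_on _ _ _ _ (fun u : 'rV[R]_n => u 0 j) _ _ (@phi_open _ _ M a));
  last first.
- by exists p.
- by move=> u; rewrite inE => -[q aq <-]; rewrite !phiK.
by rewrite derive_coord /evec mxE eqxx eq_sym.
Qed.

Lemma pd_smooth a b (i j : 'I_n) k :
  Ck_on k (phi a @` (dom a `&` dom b))
    ('D_(evec R i) (fun u => phi b (psi a u) 0 j)).
Proof. by have /Ck_on_succ[_ d] := transition_smooth a b j k.+1; apply: d. Qed.

Section Extension.
Context (a0 : chart M) (p0 : M) (x : 'rV[R]_n) (r : R) (a0p0 : dom a0 p0).
Let c := phi a0 p0.
Context (r0 : 0 < r) (box_dom : box c r `<=` phi a0 @` dom a0).

(** The field constant in the chart [a0], cut off by a bump normalized to 1 at [p0], and expressed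
    in the chart [b] by the Jacobian. *)
Definition extension b q : 'rV[R]_n :=
  if `[< dom a0 q >] then
    (box_bump c r (phi a0 q) / box_bump c r c) *: (x *m Defs.jacobian a0 b q)
  else 0.

Lemma extension_transition a b q : dom a q -> dom b q ->
  extension b q = extension a q *m Defs.jacobian a b q.
Proof.
move=> aq bq; rewrite /extension; case: asboolP => [a0q|_]; last by rewrite mul0mx.
by rewrite -scalemxAl -mulmxA -jacobian_trans.
Qed.

Lemma extension_center : extension a0 p0 = x.
Proof.
rewrite /extension; case: asboolP => // _.
by rewrite divff ?box_bump_center// scale1r jacobian_id// mulmx1.
Qed.

(** A compact subset of a Hausdorff space is closed. Hence the field vanishes on an open set
    containing every point outside [dom a0], which makes the extension by zero smooth. *)
Lemma extension_support_closed : closed (psi a0 @` box c r).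
Proof.
apply: compact_closed; first exact: manifold_hausdorff.
apply: continuous_compact; last exact: box_compact.
exact: continuous_subspaceW (@psi_continuous _ _ M a0).
Qed.

Lemma extension_out b q : ~ (psi a0 @` box c r) q -> extension b q = 0.
Proof.
move=> out; rewrite /extension; case: asboolP => // a0q.
rewrite box_bump_out// ?mul0r ?scale0r// => inb; apply: out.
by exists (phi a0 q) => //; exact: phiK.
Qed.

Lemma extension_smooth b (i : 'I_n) :
  smooth_on (phi b @` dom b) (fun u => extension b (psi b u) 0 i).
Proof.
move=> k; apply: Ck_on_local => _ [q bq <-].
(* On the overlap with [a0] the field is given by the bump, the constants [x 0 l] and partial
   derivatives of the transition, all smooth there. *)
have [a0q|na0q] := pselect (dom a0 q).
  have Uop := @overlap_open b a0; set U := phi b @` _ in Uop.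
  exists U; first by exists q.
  have sub u : U u -> (phi a0 @` (dom a0 `&` dom b)) (phi a0 (psi b u)).
    by case=> q' [bq' aq'] <-; rewrite phiK//; exists q'.
  apply: (@eq_Ck_on R n k U (fun u => box_bump c r (phi a0 (psi b u)) *
     ((box_bump c r c)^-1 * \sum_(l < n) x 0 l *
       'D_(evec R l) (fun w => phi b (psi a0 w) 0 i) (phi a0 (psi b u))))) => //.
    move=> u; rewrite inE => -[q' [bq' aq'] <-]; rewrite phiK// /extension.
    case: asboolP => // _; rewrite !mxE mulrA; congr (_ * _).
    by apply: eq_bigr => l _; rewrite mxE.
  apply: Ck_onM => //.
    apply: (Ck_on_comp Uop sub (f := box_bump c r)).
      exact: box_bump_smooth (@overlap_open _ _) k.
    by move=> j; exact: transition_smooth.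
  apply: Ck_onM => //; first exact: Ck_on_cst.
  apply: Ck_on_sum => // l _; apply: Ck_onM => //; first exact: Ck_on_cst.
  apply: (Ck_on_comp Uop sub (f := 'D_(evec R l) (fun w => phi b (psi a0 w) 0 i))).
    exact: pd_smooth.
  by move=> j; exact: transition_smooth.
(* Outside [dom a0] the point [q] has a neighbourhood missing the closed support, where the field is
   0. *)
have Uop := @chart_image_open b _ (closed_openC extension_support_closed).
set U := phi b @` _ in Uop; exists U.
  exists q => //; split=> // -[w bw wq]; apply: na0q.
  by have [q' a0q' q'w] := box_dom bw; rewrite -wq -q'w phiK.
apply: (eq_Ck_on Uop _ (Ck_on_cst k U 0)).
by move=> u; rewrite inE => -[q' [bq' out] <-]; rewrite phiK// extension_out// mxE.
Qed.

Definition extension_field : vector_field M :=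
  VectorField extension_smooth extension_transition.

End Extension.

Lemma vector_field_through a p (x : 'rV[R]_n) : dom a p ->
  exists X : vector_field M, X a p = x.
Proof.
move=> ap; have /box_sub_nbhs[r r0 rD] : nbhs (phi a p) (phi a @` dom a).
  by apply: open_nbhs_nbhs; split; [exact: phi_open|exists p].
by exists (extension_field x r0 rD); exact: extension_center.
Qed.

End Charts.

(** * Symmetries of the curvature *)

Section InverseMatrix.
Context {R : realType} {n : nat} (D : set 'rV[R]_n).
Context (Dop : open D).

Lemma Ck_on_det (m k : nat) (A : 'rV[R]_n -> 'M[R]_m) :
  (forall i j, Ck_on k D (fun u => A u i j)) -> Ck_on k D (fun u => \det (A u)).
Proof.
move=> CA; apply: Ck_on_sum => // s _; apply: Ck_onM => //; first exact: Ck_on_cst.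
by apply: Ck_on_prod.
Qed.

(** Cramer's formula: the entries of the inverse are cofactors divided by the determinant, both
    polynomial in the entries of [A]. *)
Lemma differentiable_invmx (m : nat) (A : 'rV[R]_n -> 'M[R]_m) (i j : 'I_m) u :
  (forall i j, Ck_on 1 D (fun u => A u i j)) ->
  (forall u, D u -> A u \in unitmx) -> D u ->
  differentiable (fun u => invmx (A u) i j) u.
Proof.
move=> CA unitA Du.
pose f u := (\det (A u))^-1 * cofactor (A u) j i.
apply: (near_eq_differentiable (f := f)).
  apply: (near_eq_on Dop) => // v; rewrite inE => Dv.
  by rewrite /f /invmx unitA// !mxE.
have detA : differentiable (fun u => \det (A u)) u.
  by have /Ck_on_succ[d _] := Ck_on_det CA; exact: d.
apply: differentiableM.
  apply: (@differentiable_comp _ _ _ _ (fun u => \det (A u)) GRing.inv) => //.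
  by apply: differentiable_Rinv; rewrite -unitfE -unitmxE unitA.
apply: differentiableM; first exact: differentiable_cst.
have /Ck_on_succ[d _] : Ck_on 1 D (fun u => \det (row' j (col' i (A u)))).
  apply: Ck_on_det => i' j'.
  rewrite (_ : (fun u => _) = fun u => A u (lift j i') (lift i j')) //.
  by apply/funext => v; rewrite !mxE.
exact: d.
Qed.

End InverseMatrix.

(** * Calculus of partial derivatives in a chart *)

Section PartialDerivatives.
Context {R : realType} {n : nat} {M : manifold R n} (a : chart M).
Implicit Types (f g : M -> R) (p : M).

Definition chart_differentiable f p := differentiable (fun u => f (psi a u)) (phi a p).

Definition chart_smooth f := smooth_on (phi a @` dom a) (fun u => f (psi a u)).

Lemma eq_pd (i : 'I_n) f g p : (forall q, dom a q -> f q = g q) -> dom a p ->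
  pd a i f p = pd a i g p.
Proof.
move=> fg ap; apply: (derive_eq_on _ (@phi_open _ _ M a)); last by exists p.
by move=> u; rewrite inE => -[q aq <-]; rewrite phiK ?fg.
Qed.

Lemma eq_chart_differentiable f g p : (forall q, dom a q -> f q = g q) -> dom a p ->
  chart_differentiable f p -> chart_differentiable g p.
Proof.
move=> fg ap; apply: near_eq_differentiable.
apply: (near_eq_on (@phi_open _ _ M a)); last by exists p.
by move=> u; rewrite inE => -[q aq <-]; rewrite phiK ?fg.
Qed.

Lemma chart_differentiableM f g p : chart_differentiable f p ->
  chart_differentiable g p -> chart_differentiable (fun q => f q * g q) p.
Proof. by move=> df dg; exact: differentiableM. Qed.

Lemma chart_differentiable_sum m (F : 'I_m -> M -> R) p :
  (forall i, chart_differentiable (F i) p) ->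
  chart_differentiable (fun q => \sum_(i < m) F i q) p.
Proof.
move=> dF; rewrite /chart_differentiable.
rewrite (_ : (fun u => _) = \sum_(i < m) (fun u => F i (psi a u))).
  exact: differentiable_sum.
by apply/funext => u; rewrite fct_sumE.
Qed.

Lemma pdD (i : 'I_n) f g p : chart_differentiable f p -> chart_differentiable g p ->
  pd a i (fun q => f q + g q) p = pd a i f p + pd a i g p.
Proof. by move=> df dg; rewrite [LHS]deriveD//; exact: diff_derivable. Qed.

Lemma pdM (i : 'I_n) f g p : chart_differentiable f p -> chart_differentiable g p ->
  dom a p ->
  pd a i (fun q => f q * g q) p = f p * pd a i g p + g p * pd a i f p.
Proof.
move=> df dg ap; rewrite [LHS]deriveM; last 2 first.
- exact: diff_derivable.
- exact: diff_derivable.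
by rewrite phiK.
Qed.

Lemma pd_sum (i : 'I_n) m (F : 'I_m -> M -> R) p :
  (forall i, chart_differentiable (F i) p) ->
  pd a i (fun q => \sum_(j < m) F j q) p = \sum_(j < m) pd a i (F j) p.
Proof.
move=> dF; rewrite /pd -(@derive_sum _ _ _ _ (fun j u => F j (psi a u))).
  by congr (derive _ _ _); apply/funext => u; rewrite fct_sumE.
by move=> j; exact: diff_derivable (dF j).
Qed.

Lemma pdZ (i : 'I_n) (c : R) f p : chart_differentiable f p ->
  pd a i (fun q => c * f q) p = c * pd a i f p.
Proof.
by move=> df; rewrite [LHS]deriveMl//; exact: diff_derivable.
Qed.

Lemma chart_smooth_differentiable f p : chart_smooth f -> dom a p ->
  chart_differentiable f p.
Proof.
by move=> sf ap; have /Ck_on_succ[d _] := sf 1%N; apply: d; exists p.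
Qed.

Lemma chart_smooth_pd f (i : 'I_n) : chart_smooth f -> chart_smooth (pd a i f).
Proof.
move=> sf k; have /Ck_on_succ[_ d] := sf k.+1.
apply: (eq_Ck_on (@phi_open _ _ M a) _ (d i)).
by move=> u; rewrite inE => -[q aq <-]; rewrite /pd phiK.
Qed.

Lemma evec_norm (i : 'I_n) : `|evec R i| <= 1.
Proof.
rewrite [leLHS]/Num.Def.normr/= mx_normrE (bigmax_le _ ler01)//= => -[j k] _.
by rewrite mxE; case: (_ && _); rewrite ?normr1 ?normr0.
Qed.

Lemma pd_comm f (i j : 'I_n) p : chart_smooth f -> dom a p ->
  pd a i (pd a j f) p = pd a j (pd a i f) p.
Proof.
move=> sf ap; have Du : (phi a @` dom a) (phi a p) by exists p.
have Dnear := open_nbhs_nbhs (conj (@phi_open _ _ M a) Du).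
pose F u := f (psi a u).
(* In an iterated [pd] the inner [phi a] and the outer [psi a] cancel on the chart image, which
   leaves iterated derivatives of [F]. *)
have pdE k l : pd a k (pd a l f) p = 'D_(evec R k) ('D_(evec R l) F) (phi a p).
  apply: (derive_eq_on _ (@phi_open _ _ M a)) => //.
  by move=> u; rewrite inE => -[q aq <-]; rewrite /pd phiK.
have /Ck_on_succ[dF ddF] : Ck_on 2 (phi a @` dom a) F by exact: sf.
have Cd k l : {for phi a p, continuous ('D_(evec R k) ('D_(evec R l) F))}.
  by have /Ck_on_succ[_ d] := ddF l; exact: d.
rewrite !pdE; apply: derive_comm;
  [exact: evec_norm|exact: evec_norm| | | |exact: Cd|exact: Cd].
- exact: filterS Dnear.
- by have /Ck_on_succ[d _] := ddF i; exact: filterS Dnear.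
- by have /Ck_on_succ[d _] := ddF j; exact: filterS Dnear.
Qed.

End PartialDerivatives.

(** * Christoffel symbols and the components of the curvature *)

Section CurvatureSymmetries.
Context {R : realType} {n : nat} {M : semiRiemannian R n} (a : chart M).
Implicit Types (p q : M) (i j k l m s t : 'I_n).

Let g i j q : R := metric a q i j.
Let gi i j q : R := ginv a q i j.

Lemma metric_symE i j q : dom a q -> g i j q = g j i q.
Proof. by move=> aq; rewrite /g -[in LHS](Defs.metric_sym aq) mxE. Qed.

Lemma ginv_sym q : dom a q -> (ginv a q)^T = ginv a q.
Proof. by move=> aq; rewrite /ginv trmx_inv Defs.metric_sym. Qed.

Lemma ginv_symE i j q : dom a q -> gi i j q = gi j i q.
Proof. by move=> aq; rewrite /gi -[in LHS](ginv_sym aq) mxE. Qed.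

Lemma ginv_metric i j q : dom a q -> \sum_s g i s q * gi s j q = (i == j)%:R.
Proof.
move=> aq; have /matrixP /(_ i j) := mulmxV (metric_nondeg aq).
by rewrite !mxE.
Qed.

Lemma chart_differentiable_ginv i j p : dom a p -> chart_differentiable a (gi i j) p.
Proof.
move=> ap; apply: (@differentiable_invmx _ _ _ (@phi_open _ _ M a) _
  (fun u => metric a (psi a u))) => //.
- by move=> k l; exact: metric_smooth.
- by move=> _ [q aq <-]; rewrite phiK//; exact: metric_nondeg.
Qed.

(* The Christoffel symbol [ij, l] of the first kind. *)
Definition christoffel1 i j l q : R :=
  2^-1 * (pd a i (g j l) q + pd a j (g i l) q - pd a l (g i j) q).

Lemma christoffelE i j k q :
  christoffel a k i j q = \sum_l gi k l q * christoffel1 i j l q.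
Proof.
rewrite /christoffel mulr_sumr; apply: eq_bigr => l _.
by rewrite /christoffel1 mulrCA.
Qed.

Lemma christoffel1_sym i j l q : dom a q -> christoffel1 i j l q = christoffel1 j i l q.
Proof.
move=> aq; rewrite /christoffel1 (@eq_pd _ _ _ _ l (g i j) (g j i))//.
  by rewrite [pd a i _ _ + _]addrC.
by move=> ? ?; exact: metric_symE.
Qed.

(** Compatibility of the Levi-Civita connection with the metric, in coordinates. *)
Lemma pd_metric i l m q : dom a q ->
  pd a i (g m l) q = christoffel1 i m l q + christoffel1 i l m q.
Proof.
move=> aq; rewrite /christoffel1 (@eq_pd _ _ _ _ i (g l m) (g m l))//; last first.
  by move=> ? ?; exact: metric_symE.
rewrite (@eq_pd _ _ _ _ l (g i m) (g m i))//; last by move=> ? ?; exact: metric_symE.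
rewrite (@eq_pd _ _ _ _ m (g i l) (g l i))//; last by move=> ? ?; exact: metric_symE.
by field.
Qed.

Lemma chart_differentiable_christoffel1 i j l p : dom a p ->
  chart_differentiable a (christoffel1 i j l) p.
Proof.
move=> ap; have d i' j' l' : chart_differentiable a (pd a i' (g j' l')) p.
  apply: chart_smooth_differentiable => //; apply: chart_smooth_pd.
  exact: metric_smooth.
apply: chart_differentiableM; first exact: differentiable_cst.
apply: differentiableB; last exact: d.
by apply: differentiableD; exact: d.
Qed.

Lemma chart_differentiable_christoffel i j k p : dom a p ->
  chart_differentiable a (christoffel a k i j) p.
Proof.
move=> ap; apply: (eq_chart_differentiable _ ap
  (f := fun q => \sum_l gi k l q * christoffel1 i j l q)).
  by move=> q _; rewrite christoffelE.
apply: chart_differentiable_sum => l; apply: chart_differentiableM.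
  exact: chart_differentiable_ginv.
exact: chart_differentiable_christoffel1.
Qed.

(* Lowering an index first avoids differentiating the inverse metric
   explicitly. *)
Lemma lower_christoffel i j l q : dom a q ->
  \sum_m g m l q * christoffel a m i j q = christoffel1 i j l q.
Proof.
move=> aq; under eq_bigr => m _ do rewrite christoffelE mulr_sumr.
rewrite exchange_big (bigD1 l) //= [X in _ + X]big1 ?addr0 => [|t tl].
  under eq_bigr => m _ do rewrite mulrA (metric_symE _ _ aq).
  by rewrite -mulr_suml ginv_metric// eqxx mul1r.
under eq_bigr => m _ do rewrite mulrA (metric_symE _ _ aq).
by rewrite -mulr_suml ginv_metric// eq_sym (negPf tl) mul0r.
Qed.

(** [lower_christoffel] differentiated by the product rule, with [pd_metric] for the derivative of
    the metric. *)
Lemma pd_christoffel1 h i j l p : dom a p ->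
  \sum_m g m l p * pd a h (christoffel a m i j) p =
  pd a h (christoffel1 i j l) p -
    \sum_m christoffel a m i j p * (christoffel1 h m l p + christoffel1 h l m p).
Proof.
move=> ap; have dg k' l' : chart_differentiable a (g k' l') p.
  by apply: chart_smooth_differentiable => //; exact: metric_smooth.
rewrite -(@eq_pd _ _ _ a h
  (fun q => \sum_m g m l q * christoffel a m i j q)) //; last first.
  by move=> q aq; rewrite lower_christoffel.
rewrite pd_sum; last first.
  move=> m; apply: chart_differentiableM => //; exact: chart_differentiable_christoffel.
rewrite -sumrB; apply: eq_bigr => m _.
rewrite pdM//; last exact: chart_differentiable_christoffel.
by rewrite pd_metric// addrK.
Qed.

(* The component R(d_i, d_j, d_k, d_l). *)
Definition Riem_coef i j k l p : R := \sum_m curvature_coef a m k i j p * g m l p.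

(** The inner product of [nabla_i d_l] and [nabla_j d_k]. *)
Definition christoffel_form i l j k p : R :=
  \sum_s christoffel1 i l s p * christoffel a s j k p.

Lemma Riem_coefE i j k l p : dom a p ->
  Riem_coef i j k l p =
    pd a i (christoffel1 j k l) p - pd a j (christoffel1 i k l) p
    - christoffel_form i l j k p + christoffel_form j l i k p.
Proof.
move=> ap; rewrite /Riem_coef /curvature_coef.
(* The curvature is a difference of two such expressions. Once the index is lowered, the quadratic
   term cancels one of the two sums coming from [pd_christoffel1]. *)
have lower h i' j' :
    \sum_m g m l p * (pd a h (christoffel a m i' j') p
      + \sum_s christoffel a m h s p * christoffel a s i' j' p)
    = pd a h (christoffel1 i' j' l) p - christoffel_form h l i' j' p.
  under eq_bigr => m _ do rewrite mulrDr.
  rewrite big_split /= (pd_christoffel1 h i' j' l ap) -addrA; congr (_ + _).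
  under [X in _ + X]eq_bigr => m _ do rewrite mulr_sumr.
  rewrite [X in _ + X]exchange_big addrC -sumrB -sumrN; apply: eq_bigr => s _.
  rewrite mulrDr -(lower_christoffel h s l ap) opprD addrA.
  rewrite [X in X - _ - _](_ : _ = christoffel a s i' j' p *
    \sum_m g m l p * christoffel a m h s p) ?subrr ?sub0r 1?mulrC//.
  by rewrite mulr_suml; apply: eq_bigr => m _; rewrite mulrA.
apply: etrans (etrans (f_equal2 (fun u v => u - v) (lower i j k) (lower j i k)) _).
  rewrite -sumrB; apply: eq_bigr => m _.
  rewrite -mulrBr sumrB mulrC; congr (_ * _).
  by rewrite opprD addrACA.
have alg (A B C D : R) : A - B - (C - D) = A - C - B + D by ring.
exact: alg.
Qed.

Lemma christoffel_form_sym i l j k p : dom a p ->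
  christoffel_form i l j k p = christoffel_form j k i l p.
Proof.
move=> ap; rewrite /christoffel_form.
under eq_bigr => s _ do rewrite christoffelE mulr_sumr.
under [RHS]eq_bigr => s _ do rewrite christoffelE mulr_sumr.
rewrite exchange_big; apply: eq_bigr => s _; apply: eq_bigr => t _.
by rewrite (ginv_symE _ _ ap); ring.
Qed.

(** The connection is torsion-free. *)
Lemma christoffel_form_comm i l j k p : dom a p ->
  christoffel_form i l j k p = christoffel_form l i j k p.
Proof. by move=> ap; apply: eq_bigr => s _; rewrite christoffel1_sym. Qed.

Definition metric_pd2 i j k l p : R := pd a i (pd a j (g k l)) p.

Lemma pd2_metric_comm i j k l p : dom a p -> metric_pd2 i j k l p = metric_pd2 j i k l p.
Proof. by move=> ap; apply: pd_comm => //; exact: metric_smooth. Qed.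

Lemma pd2_metric_sym i j k l p : dom a p -> metric_pd2 i j k l p = metric_pd2 i j l k p.
Proof.
by move=> ap; apply: eq_pd => // q aq; apply: eq_pd => // q' aq'; exact: metric_symE.
Qed.

Lemma pd_christoffel1E h i j l p : dom a p -> pd a h (christoffel1 i j l) p =
  2^-1 * (metric_pd2 h i j l p + metric_pd2 h j i l p - metric_pd2 h l i j p).
Proof.
move=> ap; have d i' j' l' : chart_differentiable a (pd a i' (g j' l')) p.
  apply: chart_smooth_differentiable => //; apply: chart_smooth_pd.
  exact: metric_smooth.
have dN : chart_differentiable a (fun q => - 1 * pd a l (g i j) q) p.
  by apply: chart_differentiableM => //; exact: differentiable_cst.
rewrite (@eq_pd _ _ _ a h _ (fun q =>
  2^-1 * (pd a i (g j l) q + pd a j (g i l) q + - 1 * pd a l (g i j) q)))//; last first.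
  by move=> q aq; rewrite /christoffel1 mulN1r.
have dD : chart_differentiable a (fun q => pd a i (g j l) q + pd a j (g i l) q) p.
  exact: differentiableD (d _ _ _) (d _ _ _).
rewrite pdZ; last exact: differentiableD dD dN.
by rewrite pdD// pdD// pdZ// mulN1r.
Qed.

(** The terms in which both [d_i] and [d_j] differentiate [g k l] cancel, as partial derivatives
    commute. In this form the symmetries of the curvature are permutations of indices. *)
Lemma Riem_coef_pd2 i j k l p : dom a p ->
  Riem_coef i j k l p =
    2^-1 * (metric_pd2 i k j l p - metric_pd2 i l j k p
            - metric_pd2 j k i l p + metric_pd2 j l i k p)
    - christoffel_form i l j k p + christoffel_form j l i k p.
Proof.
move=> ap; rewrite Riem_coefE// !pd_christoffel1E// (pd2_metric_comm j i k l ap).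
by move: metric_pd2 christoffel_form => h Q; ring.
Qed.

Lemma Riem_coef_antisym34 i j k l p : dom a p ->
  Riem_coef i j l k p = - Riem_coef i j k l p.
Proof.
move=> ap; rewrite !Riem_coef_pd2// (christoffel_form_sym i k j l ap)
  (christoffel_form_sym j k i l ap).
by move: metric_pd2 christoffel_form => h Q; ring.
Qed.

Lemma Riem_coef_antisym12 i j k l p : dom a p ->
  Riem_coef j i k l p = - Riem_coef i j k l p.
Proof.
move=> ap; rewrite !Riem_coef_pd2//.
by move: metric_pd2 christoffel_form => h Q; ring.
Qed.

Lemma Riem_coef_pair i j k l p : dom a p ->
  Riem_coef k l i j p = Riem_coef i j k l p.
Proof.
move=> ap; rewrite !Riem_coef_pd2//.
(* Each term is brought to the index order it has in [Riem_coef i j k l p]. *)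
rewrite (christoffel_form_comm k j l i ap) (christoffel_form_sym j k l i ap).
rewrite (christoffel_form_comm l i j k ap).
rewrite (christoffel_form_comm l j k i ap) (christoffel_form_sym j l k i ap).
rewrite (christoffel_form_comm k i j l ap) (christoffel_form_sym i k j l ap).
rewrite (pd2_metric_comm k i l j ap) (pd2_metric_sym i k l j ap).
rewrite (pd2_metric_comm k j l i ap) (pd2_metric_sym j k l i ap).
rewrite (pd2_metric_comm l i k j ap) (pd2_metric_sym i l k j ap).
rewrite (pd2_metric_comm l j k i ap) (pd2_metric_sym j l k i ap).
by move: metric_pd2 christoffel_form => h Q; ring.
Qed.

End CurvatureSymmetries.

(** * The Ricci tensor as a symmetric matrix *)

Section RicciTensor.
Context {R : realType} {n : nat} {M : semiRiemannian R n} (a : chart M) (p : M).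
Context (ap : dom a p).
Implicit Types (x y z w : 'rV[R]_n) (i j k l m : 'I_n).

Lemma sum_evec i (F : 'I_n -> R) : \sum_j evec R i 0 j * F j = F i.
Proof.
rewrite (bigD1 i) //= big1 ?addr0 => [|j ji]; rewrite /evec mxE eqxx /=.
  by rewrite eqxx mul1r.
by rewrite (negPf ji) mul0r.
Qed.

Lemma bilinear_mxE (B : 'M[R]_n) x y :
  (x *m B *m y^T) 0 0 = \sum_i \sum_j x 0 i * y 0 j * B i j.
Proof.
rewrite mxE exchange_big; apply: eq_bigr => j _; rewrite !mxE mulr_suml.
by apply: eq_bigr => i _; rewrite mulrAC.
Qed.

Lemma RiemE x y z w : Riem a p x y z w =
  \sum_i \sum_j \sum_k x 0 i * y 0 j * z 0 k * \sum_l Riem_coef a i j k l p * w 0 l.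
Proof.
have gD u v : gform a p (u + v) w = gform a p u w + gform a p v w.
  by rewrite /gform !mulmxDl mxE.
have g0 : gform a p 0 w = 0 by rewrite /gform !mul0mx mxE.
rewrite /Riem (_ : curvature a p x y z = \sum_i \sum_j \sum_k
    (x 0 i * y 0 j * z 0 k) *: (\row_l curvature_coef a l k i j p)); last first.
  apply/rowP => l; rewrite mxE summxE; apply: eq_bigr => i _.
  rewrite summxE; apply: eq_bigr => j _; rewrite summxE; apply: eq_bigr => k _.
  by rewrite !mxE.
rewrite (big_morph (fun u => gform a p u w) gD g0); apply: eq_bigr => i _.
rewrite (big_morph (fun u => gform a p u w) gD g0); apply: eq_bigr => j _.
rewrite (big_morph (fun u => gform a p u w) gD g0); apply: eq_bigr => k _.
rewrite /gform -!scalemxAl mxE; congr (_ * _); rewrite mxE.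
apply: eq_bigr => l _; rewrite !mxE; congr (_ * _).
by apply: eq_bigr => m _; rewrite mxE.
Qed.

Lemma Riem_antisym34 x y z w : Riem a p x y w z = - Riem a p x y z w.
Proof.
rewrite !RiemE -sumrN; apply: eq_bigr => i _; rewrite -sumrN; apply: eq_bigr => j _.
rewrite -sumrN; under eq_bigr => k _ do rewrite mulr_sumr.
rewrite exchange_big; apply: eq_bigr => l _; rewrite mulr_sumr -sumrN.
by apply: eq_bigr => k _; rewrite Riem_coef_antisym34//; ring.
Qed.

Definition Ric_mx : 'M[R]_n :=
  \matrix_(j, k) \sum_i \sum_l ginv a p i l * Riem_coef a i j k l p.

Lemma RicE x y : Ric a p x y = (x *m Ric_mx *m y^T) 0 0.
Proof.
rewrite bilinear_mxE /Ric /gtrace.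
under [RHS]eq_bigr => j _.
  under eq_bigr => k _.
    rewrite mxE mulr_sumr.
    under eq_bigr => i _ do rewrite mulr_sumr.
    over.
  rewrite exchange_big /=.
  under eq_bigr => i _ do rewrite exchange_big.
  over.
rewrite [RHS]exchange_big /=; apply: eq_bigr => i _.
rewrite [RHS]exchange_big /=; apply: eq_bigr => l _.
rewrite RiemE mulr_sumr.
transitivity (\sum_i' evec R i 0 i' * \sum_j \sum_k ginv a p i l *
    (x 0 j * y 0 k * Riem_coef a i' j k l p)).
  apply: eq_bigr => i' _; rewrite !mulr_sumr; apply: eq_bigr => j _.
  rewrite !mulr_sumr; apply: eq_bigr => k _.
  rewrite (eq_bigr (fun l' => evec R l 0 l' * Riem_coef a i' j k l' p)).
    by rewrite sum_evec; ring.
  by move=> l' _; rewrite mulrC.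
rewrite sum_evec; apply: eq_bigr => j _; apply: eq_bigr => k _; ring.
Qed.

(** Pair symmetry and the two skew symmetries reverse the four indices of the curvature. This
    exchanges [j] with [k], and also the traced indices, in which [ginv] is symmetric. *)
Lemma Ric_mx_sym : Ric_mx^T = Ric_mx.
Proof.
apply/matrixP => j k; rewrite !mxE exchange_big; apply: eq_bigr => i _.
apply: eq_bigr => l _; rewrite ginv_symE//; congr (_ * _).
rewrite -Riem_coef_pair// Riem_coef_antisym12// Riem_coef_antisym34//.
by rewrite opprK.
Qed.

End RicciTensor.

(** * The two conditions at a point *)

Section PointwiseAlgebra.
Context {R : realType} {n : nat} {M : semiRiemannian R n} (a : chart M) (p : M).
Context (ap : dom a p).
Implicit Types (x y z w : 'rV[R]_n) (i j k l : 'I_n).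

Let A := Ric_mx a p.
Let G := metric a p.
Let Gi := ginv a p.

Lemma gform_sym x y : gform a p x y = gform a p y x.
Proof.
rewrite /gform -[LHS](trace_mx11) -[RHS](trace_mx11) -mxtrace_tr.
by rewrite !trmx_mul trmxK Defs.metric_sym// mulmxA.
Qed.

Lemma gformBl x y z : gform a p (x - y) z = gform a p x z - gform a p y z.
Proof. by rewrite /gform !mulmxBl !mxE. Qed.

Lemma Ric_sym x y : Ric a p x y = Ric a p y x.
Proof.
rewrite !RicE -[LHS](trace_mx11) -[RHS](trace_mx11) -mxtrace_tr.
by rewrite !trmx_mul trmxK Ric_mx_sym// mulmxA.
Qed.

Lemma RicOpE x : RicOp a p x = x *m A *m Gi.
Proof.
rewrite /RicOp /sharp; congr (_ *m _); apply/rowP => i.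
by rewrite mxE RicE /evec trmx_delta -colE mxE.
Qed.

Lemma Ric2E x y : Ric2 a p x y = (x *m (A *m Gi *m A) *m y^T) 0 0.
Proof. by rewrite /Ric2 (RicOpP _ _ ap) RicE RicOpE !mulmxA. Qed.

(** Self-adjointness of the Ricci operator: both sides are the inner product of the images of [x]
    and [y] under it. *)
Lemma Ric_RicOp x y : Ric a p x (RicOp a p y) = Ric2 a p x y.
Proof.
rewrite /Ric2 (RicOpP _ _ ap) (Ric_sym (RicOp a p x)) -!(RicOpP _ _ ap).
exact: gform_sym.
Qed.

Lemma gform_RicOp x y : gform a p x (RicOp a p y) = Ric a p x y.
Proof. by rewrite gform_sym (RicOpP _ _ ap) Ric_sym. Qed.

(* Half the difference of the two sides of the wedge condition, up to sign. *)
Definition wedge_defect x1 x2 x y : R :=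
  Ric2 a p y x1 * gform a p x x2 - Ric2 a p x x1 * gform a p y x2
  + Ric a p y x2 * Ric a p x x1 - Ric a p x x2 * Ric a p y x1.

(* [Riem] drops out of the symmetrization because it is skew in its last two
   arguments. *)
Lemma Proj_sym34 x y z w :
  Proj a p x y z w + Proj a p x y w z = - (n%:R - 1)^-1 *
    (Ric a p y z * gform a p x w - Ric a p x z * gform a p y w
     + Ric a p y w * gform a p x z - Ric a p x w * gform a p y z).
Proof. rewrite /Proj (Riem_antisym34 ap x y z w); ring. Qed.

(** The term [Ric a p (ProjOp a p x y x1) x2] occurs on both sides and cancels. What remains is the
    symmetrization of [Proj] at [RicOp a p x1] and [x2], a multiple of the defect by a factor that
    is non-zero. *)
Lemma star_pointwise x1 x2 x y : (1 < n)%N ->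
  gform a p (P_RicOp a p x1 x y) x2 = P_Ric a p x1 x2 x y <->
  wedge_defect x1 x2 x y = 0.
Proof.
move=> n1; have n10 : (n%:R - 1 : R) != 0 by rewrite subr_eq0 pnatr_eq1 gtn_eqF.
have -> : gform a p (P_RicOp a p x1 x y) x2 =
    Proj a p x y (RicOp a p x1) x2 - Ric a p (ProjOp a p x y x1) x2.
  by rewrite /P_RicOp gformBl (ProjOpP _ _ _ _ ap) (RicOpP _ _ ap).
have -> : P_Ric a p x1 x2 x y =
    - Ric a p (ProjOp a p x y x1) x2 - Proj a p x y x2 (RicOp a p x1).
  rewrite /P_Ric; congr (_ - _).
  by rewrite Ric_sym -gform_RicOp (ProjOpP _ _ _ _ ap).
have E : Proj a p x y (RicOp a p x1) x2 + Proj a p x y x2 (RicOp a p x1)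
    = - (n%:R - 1)^-1 * wedge_defect x1 x2 x y.
  by rewrite Proj_sym34 !Ric_RicOp !gform_RicOp.
set P1 := Proj a p x y _ x2 in E *; set P2 := Proj a p x y x2 _ in E *.
set r := Ric _ _ _ _; split=> [h|h].
  have : - (n%:R - 1)^-1 * wedge_defect x1 x2 x y = 0 by rewrite -E; lra.
  by move/eqP; rewrite mulf_eq0 oppr_eq0 invr_eq0 (negPf n10) /= => /eqP.
by rewrite h mulr0 in E; lra.
Qed.

Lemma wedge_pointwise x1 x2 x y :
  kulkarni_nomizu (Ric a p) (Ric a p) x1 x2 x y
    = 2 * wedge_end a p (Ric2 a p) x y x1 x2 <->
  wedge_defect x1 x2 x y = 0.
Proof.
rewrite /kulkarni_nomizu /wedge_end /wedge_defect.
rewrite (Ric_sym x1 y) (Ric_sym x2 x) (Ric_sym x1 x) (Ric_sym x2 y).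
have alg (r1 r2 r3 r4 s t : R) :
  r1 * r2 + r2 * r1 - r3 * r4 - r4 * r3 = 2 * (s - t) <-> s - t + r4 * r3 - r2 * r1 = 0.
  by split=> h; lra.
exact: alg.
Qed.

(** With [W] the inverse metric, this turns the contraction of one index of [Y] with one of [X] into
    a matrix product. *)
Lemma contract_mxE (W X Y : 'M[R]_n) i l :
  \sum_k \sum_j W k j * (Y l j * X k i) = (Y *m W^T *m X) l i.
Proof.
rewrite mxE; apply: eq_bigr => k _; rewrite mxE mulr_suml; apply: eq_bigr => j _.
rewrite mxE; ring.
Qed.

Definition mx_trace_g (X : 'M[R]_n) : R := \sum_k \sum_j Gi k j * X k j.

Lemma mx_trace_gZ (c : R) (X : 'M[R]_n) : mx_trace_g (c *: X) = c * mx_trace_g X.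
Proof.
rewrite /mx_trace_g mulr_sumr; apply: eq_bigr => k _.
by rewrite mulr_sumr; apply: eq_bigr => j _; rewrite mxE mulrCA.
Qed.

Lemma mx_trace_metric : mx_trace_g G = n%:R.
Proof.
rewrite -(mxtrace1 R n) -(mulVmx (metric_nondeg ap)); apply: eq_bigr => k _.
rewrite mxE; apply: eq_bigr => j _; rewrite (metric_symE k j ap) //.
Qed.

Lemma bilin_evec (B : 'M[R]_n) i j : (evec R i *m B *m (evec R j)^T) 0 0 = B i j.
Proof. by rewrite /evec -rowE trmx_delta -colE !mxE. Qed.

Lemma bilin_mxZ (c : R) (C : 'M[R]_n) x y :
  (x *m (c *: C) *m y^T) 0 0 = c * (x *m C *m y^T) 0 0.
Proof. by rewrite -scalemxAr -scalemxAl mxE. Qed.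

Lemma scalE : scal a p = mx_trace_g A.
Proof.
apply: eq_bigr => i _; apply: eq_bigr => j _.
by rewrite RicE bilin_evec.
Qed.

(** * Contractions of the pointwise identity *)

Context (defect0 : forall x1 x2 x y, wedge_defect x1 x2 x y = 0).
Let B := A *m Gi *m A.

Lemma defect_coef i j k l :
  B l i * G k j - G l j * B k i + A l j * A k i - A k j * A l i = 0.
Proof.
have := defect0 (evec R i) (evec R j) (evec R k) (evec R l).
rewrite /wedge_defect /gform !Ric2E !RicE !bilin_evec -/G -/B => <-.
by rewrite [G l j * _]mulrC.
Qed.

(** Contraction over [k] and [j] gives [n B - B + A Gi A - scal A = 0], and [A Gi A] is [B]. *)
Lemma Ric2_mx : n%:R *: B = scal a p *: A.
Proof.
apply/matrixP => l i.
have : \sum_k \sum_j (B l i * (Gi k j * G k j) - Gi k j * (G l j * B k i)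
    + Gi k j * (A l j * A k i) - A l i * (Gi k j * A k j)) = 0.
  rewrite big1 // => k _; rewrite big1 // => j _.
  rewrite -[RHS](mulr0 (Gi k j)) -(defect_coef i j k l); ring.
under eq_bigr => k _ do rewrite sumrB big_split /= sumrB -!mulr_sumr.
rewrite sumrB big_split /= sumrB -!mulr_sumr !contract_mxE.
rewrite -/(mx_trace_g G) -/(mx_trace_g A) mx_trace_metric -scalE ginv_sym//.
rewrite mulmxV ?metric_nondeg// mul1mx -/B => E.
by rewrite [LHS]mxE [RHS]mxE; lra.
Qed.

(** Contraction over [l] and [i]; the two middle terms cancel again. *)
Lemma metric_scal_mx : scal a p *: A = mx_trace_g B *: G.
Proof.
apply/matrixP => k j.
have : \sum_l \sum_i (G k j * (Gi l i * B l i) - Gi l i * (B k i * G l j)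
    + Gi l i * (A k i * A l j) - A k j * (Gi l i * A l i)) = 0.
  rewrite big1 // => l _; rewrite big1 // => i _.
  rewrite -[RHS](mulr0 (Gi l i)) -(defect_coef i j k l); ring.
under eq_bigr => l _ do rewrite sumrB big_split /= sumrB -!mulr_sumr.
rewrite sumrB big_split /= sumrB -!mulr_sumr !contract_mxE.
rewrite -/(mx_trace_g B) -/(mx_trace_g A) -scalE ginv_sym//.
rewrite -/B -mulmxA mulVmx ?metric_nondeg// mulmx1 => E.
by rewrite [LHS]mxE [RHS]mxE; lra.
Qed.

Lemma Ric2_scal x y : n%:R * Ric2 a p x y = scal a p * Ric a p x y.
Proof.
by rewrite Ric2E RicE -!bilin_mxZ Ric2_mx.
Qed.

(** The trace of [Ric2_mx] gives [n tr B = scal^2], which eliminates the trace of [B] from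
    [metric_scal_mx]. *)
Lemma Ric_scal x y : (0 < n)%N ->
  scal a p * Ric a p x y = (scal a p) ^+ 2 / n%:R * gform a p x y.
Proof.
move=> n0; have nn0 : n%:R != 0 :> R by rewrite pnatr_eq0 -lt0n.
have E : n%:R * mx_trace_g B = scal a p ^+ 2.
  by rewrite -mx_trace_gZ Ric2_mx mx_trace_gZ -scalE expr2.
have -> : (scal a p) ^+ 2 / n%:R = mx_trace_g B by rewrite -E mulrC mulKf.
by rewrite RicE /gform -!bilin_mxZ metric_scal_mx.
Qed.

End PointwiseAlgebra.

(** * From the pointwise identities to the manifold *)

Theorem theorem4p5 (R : realType) (n : nat) (M : semiRiemannian R n)
    (n_ge3 : (3 <= n)%N) (M_connected : connected [set: M]) :
  (star_condition M <-> wedge_condition M) /\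
  (star_condition M ->
    (forall (a : chart M) (p : M), dom a p -> forall x y : 'rV[R]_n,
       n%:R * Ric2 a p x y = scal a p * Ric a p x y /\
       scal a p * Ric a p x y = (scal a p) ^+ 2 / n%:R * gform a p x y) /\
    ((forall (a : chart M) (p : M), dom a p ->
       (exists x y : 'rV[R]_n,
          Ric a p x y - scal a p / n%:R * gform a p x y <> 0) ->
       scal a p <> 0) ->
     Einstein M)).
Proof.
have n1 : (1 < n)%N by apply: leq_trans n_ge3.
have n0 : (0 < n)%N by apply: leq_trans n_ge3.
split.
  split=> h X1 X2 X Y a p ap.
    by apply/(wedge_pointwise ap)/(star_pointwise ap) => //; exact: h.
  by apply/(star_pointwise ap) => //; apply/(wedge_pointwise ap); exact: h.
move=> star.
have defect0 (a : chart M) (p : M) (ap : dom a p) x1 x2 x y :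
    wedge_defect a p x1 x2 x y = 0.
  apply/(star_pointwise ap) => //.
  (* Each tangent vector at [p] is the value of a global field, to which the condition applies. *)
  have [X1 <-] := vector_field_through x1 ap; have [X2 <-] := vector_field_through x2 ap.
  have [X <-] := vector_field_through x ap; have [Y <-] := vector_field_through y ap.
  exact: star.
split=> [a p ap x y|scal_neq0 a p ap x y].
  by split; [exact: Ric2_scal ap (defect0 a p ap) x y|
             exact: Ric_scal ap (defect0 a p ap) x y n0].
(* If the Einstein equation failed for [x] and [y], the scalar curvature would be non-zero at [p];
   cancelling it in [Ric_scal] gives that very equation. *)
apply/eqP; rewrite -subr_eq0; apply/negP => /negP /eqP ne.
have k0 : scal a p != 0 by apply/eqP; apply: (scal_neq0 a p ap); exists x, y.
apply: ne; apply: (mulfI k0); rewrite mulr0 mulrBr.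
by rewrite (Ric_scal ap (defect0 a p ap) x y n0); ring.
Qed.
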